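(* Let $r_1>0$, $r_2>0$, $0<p<1$, and let $v_1,v_2\neq 0$ and $b_1,b_2$ be real constants. Let $$g_1(x)=\sum_{n=0}^\infty \alpha_n x^n,\qquad \alpha_n\sim v_1\frac{\exp(r_1 n^p)}{n^{b_1}},$$ $$g_2(x)=\sum_{n=0}^\infty \beta_n x^n,\qquad \beta_n\sim v_2\frac{\exp(r_2 n^p)}{n^{b_2}},$$ and let $g(x)=g_1(x)g_2(x)=\sum_{n=0}^\infty a_n x^n$, i.e. $a_n=\sum_{k=0}^n \alpha_{n-k}\beta_k$. Then, writing $R=r_1^{\frac{1}{1-p}}+r_2^{\frac{1}{1-p}}$, $$a_n\sim \frac{\sqrt{2\pi}\,v_1v_2\,R^{\,b_1+b_2-\frac12(3-p)}\exp\!\left(n^p R^{1-p}\right)}{\sqrt{(1-p)p}\;r_1^{\frac{b_1-1/2}{1-p}}\,r_2^{\frac{b_2-1/2}{1-p}}\;n^{\,b_1+b_2+\frac p2-1}}\qquad (n\to\infty).$$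
   Context: For sequences $x_n,y_n$, $x_n\sim y_n$ means $x_n/y_n\to 1$ as $n\to\infty$. *)

(* Defs.v *)
From HB Require Import structures.
From mathcomp Require Import all_boot all_order all_algebra.
From mathcomp Require Import all_classical all_reals all_analysis.

Set Implicit Arguments.
Unset Strict Implicit.
Unset Printing Implicit Defensive.

Import Order.TTheory GRing.Theory Num.Theory.
Import numFieldNormedType.Exports.

Local Open Scope classical_set_scope.
Local Open Scope ring_scope.

(* Division by zero yields zero here, so [y] may vanish (or be a junk value)
   at finitely many indices, such as [n = 0] for [y n = n^-b], but not at
   infinitely many. *)
Definition asymp_equiv (R : realType) (x y : nat -> R) : Prop :=
  (fun n => x n / y n) @ \oo --> (1 : R).

(* Main.v *)
(** Laplace's method. With x = k/n, the k-th term of the convolution is, up to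
    powers of x and 1 - x, n^(-b1-b2) exp(n^p phi(x)) with
    phi(x) = r1 (1 - x)^p + r2 x^p, a strongly concave function whose maximum
    L = S^(1-p) is attained at x0 = r2^(1/(1-p)) / S. Viewed at scale
    k = x0 n + t n^(1-p/2), the normalised terms converge pointwise to a
    multiple of a Gaussian in t; global concavity bounds them by another
    Gaussian, because where the powers of x or 1 - x are large, t is at least
    of order n^(p/2). The sum is the integral of a step function of t, so
    dominated convergence gives the limit. *)

Require Import Defs.
From HB Require Import structures.
From mathcomp Require Import all_boot all_order all_algebra.
From mathcomp Require Import all_classical all_reals all_analysis.
From mathcomp Require Import measurable_realfun.
From mathcomp Require Import ring lra zify.

Set Implicit Arguments.
Unset Strict Implicit.
Unset Printing Implicit Defensive.

Import Order.TTheory GRing.Theory Num.Theory.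
Import numFieldNormedType.Exports.

Local Open Scope classical_set_scope.
Local Open Scope ring_scope.

(** * Second-order Taylor bound *)

(** Serves both orders of [x0] and [x] at once: the sign of the product places [c] on the same side
    of [x0] as [x]. *)
Lemma MVT_between {R : realType} (f df : R -> R) (a b x0 x : R) :
    a <= x0 <= b -> a <= x <= b ->
    (forall y, a <= y <= b -> is_derive y 1 f (df y)) ->
  exists c, [/\ a <= c <= b, 0 <= (c - x0) * (x - x0)
              & f x - f x0 = df c * (x - x0)].
Proof.
move=> /andP[ax0 x0b] /andP[ax xb] fdf.
have cont u v : a <= u -> v <= b -> {within `[u, v], continuous f}.
  move=> au vb; apply: derivable_within_continuous => y.
  rewrite in_itv/= => /andP[uy yv].
  by apply: ex_derive; apply: fdf; rewrite (le_trans au)//= (le_trans yv).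
have der u v : a <= u -> v <= b ->
    forall y, y \in `]u, v[ -> is_derive y 1 f (df y).
  move=> au vb y; rewrite in_itv/= => /andP[uy yv].
  by apply: fdf; rewrite (le_trans au (ltW uy)) (le_trans (ltW yv) vb).
have [x0x|/ltW xx0] := leP x0 x.
- have [c] := MVT_segment x0x (der _ _ ax0 xb) (cont _ _ ax0 xb).
  rewrite in_itv/= => /andP[x0c cx] ->; exists c; split => //.
  + by rewrite (le_trans ax0 x0c) (le_trans cx xb).
  + by rewrite mulr_ge0 ?subr_ge0.
- have [c] := MVT_segment xx0 (der _ _ ax x0b) (cont _ _ ax x0b).
  rewrite in_itv/= => /andP[xc cx0] E; exists c; split => //.
  + by rewrite (le_trans ax xc) (le_trans cx0 x0b).
  + by rewrite mulr_le0 ?subr_le0.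
  + by rewrite -opprB E -mulrN opprB.
Qed.

Lemma taylor2_le {R : realType} (f f' f'' : R -> R) (C a b x0 x : R) :
    a <= x0 <= b -> a <= x <= b ->
    (forall y, a <= y <= b -> is_derive y 1 f (f' y)) ->
    (forall y, a <= y <= b -> is_derive y 1 f' (f'' y)) ->
    (forall y, a <= y <= b -> f'' y <= C) ->
  f x <= f x0 + f' x0 * (x - x0) + C / 2 * (x - x0) ^+ 2.
Proof.
move=> x0ab xab df df' f''C.
(* Applying the mean value theorem twice to [f] itself would lose the 1/2. *)
pose g y := f y - f' x0 * y - C / 2 * (y - x0) ^+ 2.
have dg y : a <= y <= b -> is_derive y 1 g (f' y - f' x0 - C * (y - x0)).
  move=> /df dfy; apply: is_derive_eq.
  by rewrite /GRing.scale/=; lra.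
have [c [cab cx0 gE]] := MVT_between x0ab xab dg.
have [e [eab _ f'E]] := MVT_between x0ab cab df'.
have := f''C e eab => f''e.
suff : g x - g x0 <= 0 by rewrite /g subrr expr0n/= mulr0; lra.
(* The increment of [g] is [(f'' e - C) (c - x0) (x - x0)]: the first factor is nonpositive, the
   product of the other two nonnegative. *)
rewrite gE f'E -mulrBl -mulrA.
by rewrite mulr_le0_ge0// subr_le0.
Qed.

(** * Concavity and local expansion of real powers *)

Section powR.
Context {R : realType}.
Implicit Types (p x y : R).

Lemma continuous_powR p y : 0 < y -> {for y, continuous (fun z => z `^ p)}.
Proof.
move=> /(is_derive1_powR p) dy; apply: differentiable_continuous.
by apply/derivable1_diffP; exact: ex_derive.
Qed.

Lemma is_derive2_powR p y : 0 < y ->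
  is_derive y 1 (fun z => p * z `^ (p - 1)) (p * (p - 1) * y `^ (p - 2)).
Proof.
move=> y0; have := is_derive1_powR (p - 1) y0 => ?.
apply: is_derive_eq; rewrite /GRing.scale/= mulrA.
by congr (_ * _ `^ _); lra.
Qed.

(** On (0, 1] the second derivative [p (p - 1) z^(p - 2)] is at most [p (p - 1)], because
    [p - 1 < 0] and [z^(p - 2) >= 1]. This makes the concavity uniform, up to the endpoints. *)
Lemma powR_le_quadratic p x0 x : 0 < p < 1 -> 0 < x0 < 1 -> 0 <= x <= 1 ->
  x `^ p <= x0 `^ p + p * x0 `^ (p - 1) * (x - x0)
            - p * (1 - p) / 2 * (x - x0) ^+ 2.
Proof.
move=> /andP[p0 p1] /andP[x00 x01] /andP[x_ge0 x1].
(* At 0 the power is not differentiable. There the gap between the two sides is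
   [x0 (1 - p) (z - p / 2 * x0)] with [z = x0^(p - 1) >= x0]. *)
have [->|x0_neq0] := eqVneq x 0.
  rewrite powR0 ?gt_eqF//.
  have -> : x0 `^ p = x0 * x0 `^ (p - 1) by rewrite mulr_powRB1// ltW.
  have : x0 <= x0 `^ (p - 1).
    rewrite (@le_trans _ _ 1)//; first exact: ltW.
    by rewrite -[leLHS](powRr0 x0) ger_powR//; [rewrite x00 ltW|lra].
  set z := x0 `^ _ => x0z.
  have : 0 <= x0 * (1 - p) * (z - p / 2 * x0).
    rewrite mulr_ge0// ?mulr_ge0//; [lra|lra|].
    by have := @ler_pM _ (p / 2) 1 x0 z; lra.
  lra.
have {x_ge0 x0_neq0}x_gt0 : 0 < x by rewrite lt_neqAle eq_sym x0_neq0.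
have {}mgt0 : 0 < Num.min x x0 by rewrite lt_min x_gt0.
have := @taylor2_le R (fun z => z `^ p) (fun z => p * z `^ (p - 1))
   (fun z => p * (p - 1) * z `^ (p - 2)) (p * (p - 1)) (Num.min x x0) 1 x0 x.
rewrite !ge_min !lexx orbT/= x1 (ltW x01) => /(_ isT isT) H.
apply: le_trans (H _ _ _) _; last lra.
- by move=> y /andP[my _]; apply: is_derive1_powR; exact: lt_le_trans my.
- by move=> y /andP[my _]; apply: is_derive2_powR; exact: lt_le_trans my.
- move=> y /andP[my y1]; rewrite -[leRHS]mulr1 ler_nM2l; last nra.
  rewrite -[leLHS](powRr0 y) ger_powR//; [|lra].
  by rewrite y1 (lt_le_trans mgt0).
Qed.

(** Meant for [w n = n^p] and [x n = k / n]: since [w (x - x0)^2] stays bounded, the weighted Taylor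
    remainder, of smaller order than [(x - x0)^2], vanishes in the limit. *)
Lemma powR_taylor2_cvg p x0 l (x w : nat -> R) : 0 < x0 ->
    (forall n, 0 <= w n) -> x @ \oo --> x0 ->
    (fun n => w n * (x n - x0) ^+ 2) @ \oo --> l ->
  (fun n => w n * (x n `^ p - x0 `^ p - p * x0 `^ (p - 1) * (x n - x0)))
    @ \oo --> p * (p - 1) / 2 * x0 `^ (p - 2) * l.
Proof.
move=> x0_gt0 w0 xx0 wl.
pose K := p * (p - 1) * x0 `^ (p - 2).
have near_x0 e : 0 < e -> \forall y \near x0,
    `|y `^ p - x0 `^ p - p * x0 `^ (p - 1) * (y - x0) - K / 2 * (y - x0) ^+ 2|
      <= e * (y - x0) ^+ 2.
  move=> e0.
  have /cvgrPdist_le/(_ e e0) c2 :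
      (fun z => p * (p - 1) * z `^ (p - 2)) @ x0 --> K.
    by apply: cvgMl_tmp; exact: continuous_powR.
  have /nbhs_ballP[d /= d0 H] : \forall z \near x0,
      0 < z /\ `|K - p * (p - 1) * z `^ (p - 2)| <= e.
    by apply: filterI => //; exact: lt_nbhsr.
  near=> y.
  have yd : `|y - x0| <= d / 2.
    by rewrite distrC; near: y; apply: cvgr_dist_le => //; lra.
  have in_ball z : x0 - d / 2 <= z <= x0 + d / 2 -> ball x0 d z.
    by rewrite /ball/= => zd; rewrite ltr_distlC; lra.
  have x0ab : x0 - d / 2 <= x0 <= x0 + d / 2 by lra.
  have yab : x0 - d / 2 <= y <= x0 + d / 2 by rewrite ler_distl in yd; lra.
  (* The two-sided estimate is [taylor2_le] for the power and for its opposite, whose second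
     derivatives near [x0] are at most [K + e] and [- K + e]. *)
  have ub : y `^ p <= x0 `^ p + p * x0 `^ (p - 1) * (y - x0)
                    + (K + e) / 2 * (y - x0) ^+ 2.
    apply: (taylor2_le (f := fun z => z `^ p) (f' := fun z => p * z `^ (p - 1))
      x0ab yab) => z /in_ball/H[z0 zK].
    - exact: is_derive1_powR.
    - exact: is_derive2_powR.
    - by move: zK; rewrite ler_distlC; lra.
  have lb : - y `^ p <= - x0 `^ p + - (p * x0 `^ (p - 1)) * (y - x0)
                    + (- K + e) / 2 * (y - x0) ^+ 2.
    apply: (taylor2_le (f := fun z => - z `^ p)
      (f' := fun z => - (p * z `^ (p - 1))) x0ab yab) => z /in_ball/H[z0 zK].
    - by have := is_derive1_powR p z0 => ?; exact: is_deriveN.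
    - by have := is_derive2_powR p z0 => ?; exact: is_deriveN.
    - by move: zK; rewrite ler_distlC; lra.
  rewrite ler_norml; apply/andP; split; have := sqr_ge0 (y - x0); nra.
have -> : p * (p - 1) / 2 * x0 `^ (p - 2) * l = K / 2 * l by rewrite /K; field.
have KwE : (fun n => K / 2 * (w n * (x n - x0) ^+ 2)) @ \oo --> K / 2 * l.
  exact: cvgMl_tmp.
rewrite -[X in _ --> X]addr0.
rewrite [X in X @ _ --> _](_ : _ = (fun n => K / 2 * (w n * (x n - x0) ^+ 2)
    + w n * (x n `^ p - x0 `^ p - p * x0 `^ (p - 1) * (x n - x0)
             - K / 2 * (x n - x0) ^+ 2))); last by apply/funext => n; ring.
apply: cvgD => //; apply/cvgr0Pnorm_le => e e0.
(* [|l| + 1] is positive even when [l = 0], and eventually exceeds [w n (x n - x0)^2]. *)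
have l1 : 0 < `|l| + 1 by rewrite ltr_wpDl.
have {}near_x0 := near_x0 (e / (`|l| + 1)) (divr_gt0 e0 l1).
have {near_x0}xrem := xx0 _ near_x0.
near=> n => /=.
rewrite normrM ger0_norm//.
have xn : `|x n `^ p - x0 `^ p - p * x0 `^ (p - 1) * (x n - x0)
   - K / 2 * (x n - x0) ^+ 2| <= e / (`|l| + 1) * (x n - x0) ^+ 2.
  by near: n; exact: xrem.
apply: le_trans (ler_wpM2l (w0 n) xn) _.
rewrite mulrCA mulrAC ler_pdivrMr// ler_wpM2l ?ltW//.
have : `|l - w n * (x n - x0) ^+ 2| < 1.
  by near: n; have /cvgrPdist_lt/(_ 1 ltr01) := wl.
by have := ler_norm l; rewrite ltr_norml; lra.
Unshelve. all: by end_near.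
Qed.
End powR.

(** * Uniform bounds for powers and coefficients *)

(** Follows from [ln z <= z - 1] at [z = (e p / B) x^p], multiplied by [B / p]. As [x >= 1], the
    exponent [b] may first be raised to the positive [B = |b| + 1]. *)
Lemma powR_le_expR {R : realType} (b p e : R) : 0 < p -> 0 < e ->
  exists2 C, 0 < C & forall x, 1 <= x -> x `^ b <= C * expR (e * x `^ p).
Proof.
move=> p0 e0; pose B := `|b| + 1.
have B0 : 0 < B by rewrite ltr_wpDl.
have d0 : 0 < e * p / B by rewrite divr_gt0// mulr_gt0.
exists (expR (- (B / p * ln (e * p / B)))); first exact: expR_gt0.
move=> x x1; have x0 : 0 < x by lra.
rewrite (@le_trans _ _ (x `^ B))//.
  by rewrite ler_powR// (le_trans (ler_norm _))// lerDl.
rewrite -expRD {1}/powR gt_eqF// ler_expR.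
have := @le_ln1Dx R (e * p / B * x `^ p - 1).
have -> : 1 + (e * p / B * x `^ p - 1) = e * p / B * x `^ p by ring.
have xp0 : 0 < x `^ p by exact: powR_gt0.
rewrite lnM ?posrE// ln_powR ltrBrDl subrr mulr_gt0// => /(_ isT) H.
have {H} : p * ln x <= e * p / B * x `^ p - ln (e * p / B) by lra.
have Bp0 : 0 <= B / p by rewrite divr_ge0// ltW.
move=> /(ler_wpM2l Bp0).
have -> : B / p * (p * ln x) = B * ln x by field; rewrite gt_eqF.
move=> /le_trans; apply; rewrite mulrBr lerBlDr addrAC addNr add0r.
by rewrite le_eqVlt; apply/orP; left; apply/eqP; field; rewrite !gt_eqF.
Qed.

(* Far from [mu n] the Gaussian factor beats any power of [n]. *)
Lemma shifted_powR_bound {R : realType} (b mu p e : R) :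
    0 < mu < 1 -> 0 < p -> 0 < e ->
  exists2 C, 0 < C & forall n k : nat, (0 < n)%N -> (k <= n)%N ->
    k.+1%:R `^ (- b) <=
      C * n%:R `^ (- b) * expR (e * (n%:R `^ p * (k%:R / n%:R - mu) ^+ 2)).
Proof.
move=> /andP[mu0 mu1] p0 e0.
have e'0 : 0 < e * (mu / 2) ^+ 2 by rewrite mulr_gt0// exprn_gt0// divr_gt0.
have [C C0 CP] := powR_le_expR b p0 e'0.
have c2 : 0 < 2 `^ `|b| :> R by exact: powR_gt0.
have c3 : 0 < (mu / 2) `^ (- b) by apply: powR_gt0; rewrite divr_gt0.
exists (C + 2 `^ `|b| + (mu / 2) `^ (- b)); first by rewrite !addr_gt0.
move=> n k n0 kn.
have n0R : 0 < n%:R :> R by rewrite ltr0n.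
have n1R : 1 <= n%:R :> R by rewrite ler1n.
have E1 : 1 <= expR (e * (n%:R `^ p * (k%:R / n%:R - mu) ^+ 2)).
  rewrite -[leLHS]expR0 ler_expR mulr_ge0 ?(ltW e0)// mulr_ge0 ?powR_ge0//.
  exact: sqr_ge0.
set E := expR _ in E1 *.
have -> : k.+1%:R `^ (- b) = (k.+1%:R / n%:R) `^ (- b) * n%:R `^ (- b) :> R.
  by rewrite -powRM ?divfK ?gt_eqF ?divr_ge0.
rewrite mulrAC ler_pM2r ?powR_gt0//.
set r := _ / _; have r0 : 0 < r by rewrite divr_gt0.
(* One constant per case. If [b <= 0], use [r <= 2]. If [b > 0] and [k / n >= mu / 2], then
   [r >= mu / 2]. Otherwise only [r >= 1 / n] is known, but the Gaussian factor is at least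
   [expR (e (mu / 2)^2 n^p)], which absorbs [n^b]. *)
suff : [\/ r `^ (- b) <= C * E, r `^ (- b) <= 2 `^ `|b|
         | r `^ (- b) <= (mu / 2) `^ (- b)] by case; nra.
have [b0|b0] := leP b 0.
  apply: Or32; rewrite ler0_norm// ge0_ler_powR ?nnegrE ?oppr_ge0// ?(ltW r0)//.
  by rewrite ler_pdivrMr// -natrM ler_nat; lia.
have antitone (u v : R) : 0 < u -> u <= v -> v `^ (- b) <= u `^ (- b).
  move=> u0 uv; rewrite !powRN lef_pV2 ?posrE ?powR_gt0//; last lra.
  by rewrite ge0_ler_powR ?nnegrE; lra.
have [kmu|kmu] := leP (mu / 2) (k%:R / n%:R).
  apply: Or33; apply: antitone; first by rewrite divr_gt0.
  by rewrite (le_trans kmu)// ler_pM2r ?invr_gt0// ler_nat.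
apply: Or31; rewrite (@le_trans _ _ (n%:R^-1 `^ (- b)))//.
  apply: antitone; rewrite ?invr_gt0//.
  by rewrite ler_pdivlMr// mulVf ?gt_eqF// ler1n.
rewrite -powR_inv1 ?ler0n// -powRrM mulrN mulN1r opprK.
rewrite (le_trans (CP _ n1R))// ler_pM2l// ler_expR -[leLHS]mulrA ler_pM2l//.
rewrite mulrC ler_pM2l ?powR_gt0//.
have : 0 <= k%:R / n%:R :> R by rewrite divr_ge0.
nra.
Qed.

(** A convergent quotient is bounded. The power is taken at [n + 1] so that the bound makes sense at
    0, an index reached at both ends of the convolution. *)
Lemma asymp_equiv_bound {R : realType} (r p v b : R) (alpha : nat -> R) :
    v != 0 ->
    asymp_equiv alpha
       (fun n => v * (expR (r * (n%:R `^ p)) / (n%:R `^ b))) ->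
  exists2 C, 0 < C & forall n, `|alpha n| <=
      C * (expR (r * n%:R `^ p) * n.+1%:R `^ (- b)).
Proof.
move=> v0; set y := fun n : nat => v * _ => yP.
have /cvg_seq_bounded [M [_ HM]] : cvgn (fun n => alpha n / y n).
  by apply/cvg_ex; exists 1.
pose M' := `|M| + 1.
have M'0 : 0 < M' by rewrite ltr_wpDl.
have {HM}HM n : `|alpha n / y n| <= M'.
  by apply: HM => //; rewrite (le_lt_trans (ler_norm _))// ltrDl.
(* The factor [2^|b|] pays for replacing [n] by [n + 1], as [(n + 1) / n <= 2]. *)
pose K := M' * `|v| * 2 `^ `|b|.
have K0 : 0 < K by rewrite !mulr_gt0 ?normr_gt0 ?powR_gt0.
have gt0 n : 0 < expR (r * n%:R `^ p) * n.+1%:R `^ (- b).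
  by rewrite mulr_gt0 ?expR_gt0 ?powR_gt0.
(* At index 0 the comparison sequence may be 0, and the quotient then says nothing about [alpha 0];
   this constant covers that term. *)
pose K0' := `|alpha 0%N| / (expR (r * 0%:R `^ p) * 1%:R `^ (- b)).
exists (K + K0'); first by rewrite ltr_wpDr ?divr_ge0// ltW.
have K'0 : 0 <= K0' by rewrite /K0' divr_ge0// ltW.
move=> [|n]; first by rewrite mulrDl divfK ?gt_eqF// lerDr mulr_ge0// ltW.
rewrite (@le_trans _ _ (K * (expR (r * n.+1%:R `^ p) * n.+2%:R `^ (- b))))//;
  last by rewrite ler_pM2r// lerDl.
have n0 : 0 < n.+1%:R :> R by [].
have y0 : y n.+1 != 0.
  by rewrite mulf_neq0// gt_eqF// divr_gt0 ?expR_gt0 ?powR_gt0.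
rewrite -[alpha _](divfK y0) normrM.
rewrite (le_trans (ler_wpM2r (normr_ge0 _) (HM _)))//.
rewrite /K -2!mulrA ler_pM2l// normrM ler_pM2l ?normr_gt0//.
rewrite ger0_norm; last by rewrite divr_ge0 ?expR_ge0 ?powR_ge0.
rewrite mulrCA ler_pM2l ?expR_gt0// -powRN.
have -> : n.+1%:R `^ (- b) = (n.+2%:R / n.+1%:R) `^ b * n.+2%:R `^ (- b) :> R.
  rewrite !powRN powRM ?invr_ge0// -mulrA.
  rewrite -(powR_inv1 (ler0n _ n.+1)) -powRrM mulN1r powRN mulrCA.
  by rewrite divff ?mulr1// gt_eqF ?powR_gt0.
rewrite ler_pM2r ?powR_gt0//.
rewrite (@le_trans _ _ ((n.+2%:R / n.+1%:R) `^ `|b|))//.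
  by rewrite ler_powR ?ler_norm// ler_pdivlMr// mul1r ler_nat.
rewrite ge0_ler_powR ?nnegrE// ?divr_ge0//.
by rewrite ler_pdivrMr// -natrM ler_nat mul2n -addnn addnS ltnS ltnS leq_addr.
Qed.

(** * Riemann sums by dominated convergence *)

(* The scaled sum is the integral of [t |-> c n (floor (m n + t h n))]. *)
Lemma riemann_sum_dominated_cvg {R : realType} (c : nat -> nat -> R)
    (N : nat -> nat) (m h : nat -> R) (G D : R -> R) :
    (forall n, 0 < h n) ->
    lebesgue_measure.-integrable setT (EFin \o D) ->
    (forall t, 0 <= D t) ->
    (forall n k t, (k < N n)%N -> k%:R <= m n + t * h n < k.+1%:R ->
       `|c n k| <= D t) ->
    (forall t, \forall n \near \oo, 0 <= m n + t * h n < (N n)%:R) ->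
    (forall t, (fun n => c n (Num.trunc (m n + t * h n))) @ \oo --> G t) ->
  (fun n => ((\sum_(k < N n) c n k) / h n)%:E) @ \oo -->
    (\int[lebesgue_measure]_t (G t)%:E)%E.
Proof.
move=> h0 intD D0 cD nearN cG.
(* The values of [t] that select the index [k]; the length [1 / h n] of this interval produces the
   division by [h n]. *)
pose I n k : set R := `[(k%:R - m n) / h n, (k.+1%:R - m n) / h n[%classic.
have inI n k t : (t \in I n k) = (k%:R <= m n + t * h n < k.+1%:R).
  rewrite mem_setE/= in_itv/= ler_pdivrMr// ltr_pdivlMr//.
  by rewrite lerBlDl ltrBrDl.
have uniqI n k l t : t \in I n k -> t \in I n l -> k = l.
  rewrite !inI => /andP[a1 a2] /andP[b1 b2].
  have : (k%:R < l.+1%:R :> R) by lra.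
  have : (l%:R < k.+1%:R :> R) by lra.
  by rewrite !ltr_nat; lia.
pose F n t := \sum_(k < N n) c n k * \1_(I n k) t.
have FE n t (k : 'I_(N n)) : t \in I n k -> F n t = c n k.
  move=> tk; rewrite /F (bigD1 k)//= big1 => [|j jk].
    by rewrite indicE tk mulr1 addr0.
  rewrite indicE; case: (boolP (t \in I n j)) => [tj|]; last by rewrite mulr0.
  by move/eqP: jk; case; apply: val_inj; exact: uniqI tj tk.
have mI n k : measurable (I n k) by exact: measurable_itv.
have muI n k : lebesgue_measure (I n k) = (h n)^-1%:E.
  rewrite lebesgue_measure_itv/= lte_fin ltr_pM2r ?invr_gt0//.
  rewrite ltrD2r ltr_nat ltnSn -EFinB -mulrBl.
  by congr (_%:E); rewrite -natr1; field; rewrite gt_eqF.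
have intI n k : lebesgue_measure.-integrable setT (EFin \o \1_(I n k)).
  exact: integrable_indic_itv.
have intI1 n k :
    (\int[lebesgue_measure]_t (\1_(I n k) t)%:E)%E = (h n)^-1%:E.
  rewrite -(muI n k) -[in RHS](setIT (I n k)).
  exact: (@integral_indic _ _ _ lebesgue_measure setT measurableT _ (mI n k)).
have intF n : (\int[lebesgue_measure]_t (F n t)%:E)%E
            = ((\sum_(k < N n) c n k) / h n)%:E.
  under eq_integral do rewrite /F -sumEFin.
  rewrite integral_sum//=; last first.
    by move=> k; under eq_fun do rewrite EFinM;
      apply: integrableZl; [|exact: intI].
  rewrite big_distrl/= -sumEFin; apply: eq_bigr => k _.
  under eq_integral do rewrite EFinM.
  rewrite EFinM -(intI1 n k); exact: integralZl (intI n k) _.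
under eq_fun do rewrite -intF.
apply: (@dominated_cvg _ _ _ lebesgue_measure setT measurableT
   (fun n t => (F n t)%:E) (fun t => (G t)%:E) (EFin \o D)) => //.
- move=> n; apply/measurable_EFinP; apply: measurable_sum => k.
  by apply: measurable_funM => //; apply: measurable_indic; exact: mI.
- move=> t _; apply: cvg_EFin; first exact: nearW.
  rewrite (_ : fine \o _ = (fun n => F n t))//.
  apply: cvg_trans (cG t); apply: near_eq_cvg.
  near=> n.
  have /andP[y0 yN] : 0 <= m n + t * h n < (N n)%:R by near: n; exact: nearN.
  have /andP[ty yt] := truncn_itv y0.
  have kN : (Num.trunc (m n + t * h n) < N n)%N.
    by rewrite -(ltr_nat R) (le_lt_trans ty).
  by rewrite (FE n t (Ordinal kN))// inI ty yt.
- move=> n t _; rewrite /= lee_fin.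
  have [[k tk]|noI] := pselect (exists k : 'I_(N n), t \in I n k).
    by rewrite (FE _ _ _ tk); apply: cD (ltn_ord k) _; rewrite -inI.
  rewrite /F big1 ?normr0// => k _; rewrite indicE.
  by case: (boolP (t \in I n k)) => [tk|]; [case: noI; exists k|rewrite mulr0].
Unshelve. all: by end_near.
Qed.

(** * Coefficients along indices proportional to n *)

Lemma natr_powRN_cvg0 {R : realType} (q : R) : 0 < q ->
  (fun n : nat => n%:R `^ (- q)) @ \oo --> (0 : R).
Proof.
move=> q0; apply/cvgr0Pnorm_le => e e0.
have [M M0 MP] : exists2 M : R, 0 < M & M `^ (- q) <= e.
  exists (e `^ (- q^-1)); first exact: powR_gt0.
  by rewrite -powRrM mulrNN mulVf ?gt_eqF// powRr1// ltW.
have : \forall n \near \oo, M <= n%:R by exact: nbhs_infty_ger.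
apply: filterS => n Mn.
rewrite ger0_norm ?powR_ge0//; apply: le_trans MP.
have n0 : 0 < n%:R :> R by exact: lt_le_trans Mn.
rewrite !powRN lef_pV2 ?posrE ?powR_gt0//.
rewrite ge0_ler_powR ?nnegrE//; exact: ltW.
Qed.

Lemma cvg_infty_of_ratio {R : realType} (k : nat -> nat) (l : R) : 0 < l ->
  (fun n => (k n)%:R / n%:R) @ \oo --> l -> k @ \oo --> \oo.
Proof.
move=> l0 kl; apply/cvgnyPge => A.
have l2 : l / 2 < l by lra.
near=> n.
have kn : l / 2 < (k n)%:R / n%:R by near: n; exact: (cvgr_gt _ kl).
have An : 2 * A%:R / l <= n%:R by near: n; exact: nbhs_infty_ger.
have n0 : 0 < n%:R :> R by rewrite ltr0n; near: n; exact: nbhs_infty_gt.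
rewrite -(ler_nat R).
rewrite ltr_pdivlMr// in kn; rewrite ler_pdivrMr// in An.
lra.
Unshelve. all: by end_near.
Qed.

(** Knowing [k n = c n + o(n)] fixes [(k n)^b] up to a factor tending to 1, but not
    [expR (r (k n)^p)]. The exponential therefore keeps its exact argument, and only the power is
    expressed in [n]. *)
Lemma asymp_equiv_ratio_cvg {R : realType} (r p v b c : R) (alpha : nat -> R)
    (k : nat -> nat) :
    v != 0 -> 0 < c ->
    asymp_equiv alpha
       (fun n => v * (expR (r * (n%:R `^ p)) / (n%:R `^ b))) ->
    (fun n => (k n)%:R / n%:R) @ \oo --> c ->
  (fun n => alpha (k n) / (expR (r * (k n)%:R `^ p) / n%:R `^ b)) @ \oo -->
    v * c `^ (- b).
Proof.
move=> v0 c0 av kc.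
have koo := cvg_infty_of_ratio c0 kc.
have H1 := cvg_comp _ _ koo av.
have H2 : (fun n => ((k n)%:R / n%:R) `^ (- b)) @ \oo --> c `^ (- b).
  apply: (cvg_comp _ (fun z : R => z `^ (- b)) kc); exact: continuous_powR.
rewrite -[X in _ --> X]mul1r.
apply: cvg_trans (cvgM H1 (cvgMl_tmp (a := v) H2)); apply: near_eq_cvg.
near=> n.
have n0 : (0 < n)%N by near: n; exact: nbhs_infty_gt.
have k0 : (0 < k n)%N by near: n; exact: (cvgnyPgt _).1 koo 0%N.
have nb : n%:R `^ b != 0 :> R by rewrite gt_eqF ?powR_gt0 ?ltr0n.
have kb : (k n)%:R `^ b != 0 :> R by rewrite gt_eqF ?powR_gt0 ?ltr0n.
have E : expR (r * (k n)%:R `^ p) != 0 by rewrite gt_eqF ?expR_gt0.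
rewrite /= powRM ?invr_ge0// -(powR_inv1 (ler0n _ n)) -powRrM mulN1r opprK.
by rewrite powRN; field; rewrite kb E v0 nb.
Unshelve. all: by end_near.
Qed.

(** * The phase function *)

(* [r1 (1 - x)^p + r2 x^p] on [0, 1] is critical at [x0] exactly when the two
   derivatives balance; [L] is their common value (over [p]), and then also the
   maximum. *)
Lemma phase_le {R : realType} (p r1 r2 x0 L x : R) :
    0 < p < 1 -> 0 < r1 -> 0 < r2 -> 0 < x0 < 1 ->
    r1 * (1 - x0) `^ (p - 1) = L -> r2 * x0 `^ (p - 1) = L -> 0 <= x <= 1 ->
  r1 * (1 - x) `^ p + r2 * x `^ p <=
    L - p * (1 - p) * (r1 + r2) / 2 * (x - x0) ^+ 2.
Proof.
move=> p01 r10 r20 x001 L1 L2 x01.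
have p0 : 0 < p by case/andP: p01.
have /andP[x00 x0lt1] := x001.
have x00' : 0 < 1 - x0 by rewrite subr_gt0.
have := powR_le_quadratic p01 x001 x01.
have x001' : 0 < 1 - x0 < 1 by lra.
have x01' : 0 <= 1 - x <= 1 by lra.
have := powR_le_quadratic p01 x001' x01'.
(* Once [x0^p] is split as [x0 * x0^(p - 1)], and likewise for [1 - x0], the balance replaces every
   power by [L]: the linear terms cancel and the constants add up to [L]. *)
rewrite -(mulr_powRB1 (ltW x00) p0) -(mulr_powRB1 (ltW x00') p0).
move=> /(ler_wpM2l (ltW r10)) H1 /(ler_wpM2l (ltW r20)) H2.
apply: le_trans (lerD H1 H2) _.
move: L1 L2; set u := (1 - x0) `^ _; set w := x0 `^ _ => L1 L2.
rewrite le_eqVlt; apply/orP; left; apply/eqP.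
transitivity ((r1 * u) * ((1 - x0) - p * (x - x0))
   + (r2 * w) * (x0 + p * (x - x0))
   - p * (1 - p) * (r1 + r2) / 2 * (x - x0) ^+ 2); first by field.
by rewrite L1 L2; field.
Qed.

(** By the balance, the second derivative of the phase at [x0] is
    [p (p - 1) L (1 / (1 - x0) + 1 / x0)]; half of it is the coefficient of [l]. *)
Lemma phase_cvg {R : realType} (p r1 r2 x0 L l : R) (x w : nat -> R) :
    0 < p < 1 -> 0 < x0 < 1 ->
    r1 * (1 - x0) `^ (p - 1) = L -> r2 * x0 `^ (p - 1) = L ->
    (forall n, 0 <= w n) -> x @ \oo --> x0 ->
    (fun n => w n * (x n - x0) ^+ 2) @ \oo --> l ->
  (fun n => w n * (r1 * (1 - x n) `^ p + r2 * x n `^ p - L)) @ \oo -->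
    - (p * (1 - p) * L / (2 * x0 * (1 - x0)) * l).
Proof.
move=> /andP[p0 p1] /andP[x00 x01] L1 L2 w0 xx0 wl.
have x0' : 0 < 1 - x0 by rewrite subr_gt0.
have H2 := powR_taylor2_cvg (p := p) x00 w0 xx0 wl.
have H1 : (fun n => w n * ((1 - x n) `^ p - (1 - x0) `^ p
     - p * (1 - x0) `^ (p - 1) * ((1 - x n) - (1 - x0)))) @ \oo -->
     p * (p - 1) / 2 * (1 - x0) `^ (p - 2) * l.
  apply: powR_taylor2_cvg => //; first by apply: cvgB => //; exact: cvg_cst.
  apply: cvg_trans wl; apply: near_eq_cvg; apply: nearW => n.
  by congr (_ * _); ring.
have powR2 y : 0 < y -> y `^ (p - 2) = y `^ (p - 1) / y.
  move=> y0; rewrite (_ : p - 2 = (p - 1) - 1); last lra.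
  by rewrite powRB ?powRr1 ?(ltW y0)// (gt_eqF y0) implybT.
have <- : r1 * (p * (p - 1) / 2 * (1 - x0) `^ (p - 2) * l)
    + r2 * (p * (p - 1) / 2 * x0 `^ (p - 2) * l)
    = - (p * (1 - p) * L / (2 * x0 * (1 - x0)) * l).
  rewrite !powR2//; transitivity ((p * (p - 1) / 2 / (1 - x0)
    * (r1 * (1 - x0) `^ (p - 1)) + p * (p - 1) / 2 / x0
    * (r2 * x0 `^ (p - 1))) * l); first by field; rewrite !gt_eqF.
  by rewrite L1 L2; field; rewrite !gt_eqF.
apply: cvg_trans (cvgD (cvgMl_tmp (a := r1) H1) (cvgMl_tmp (a := r2) H2)).
apply: near_eq_cvg; apply: nearW => n; symmetry; rewrite fctE/=.
rewrite -(mulr_powRB1 (ltW x00) p0) -(mulr_powRB1 (ltW x0') p0).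
transitivity (w n * (r1 * (1 - x n) `^ p + r2 * x n `^ p
   - ((r1 * (1 - x0) `^ (p - 1)) * ((1 - x0) - p * (x n - x0))
      + (r2 * x0 `^ (p - 1)) * (x0 + p * (x n - x0))))).
  by rewrite L1 L2; ring.
by ring.
Qed.

(** * Gaussian integral *)

(** The integrand is a multiple of the centred normal density of variance [1 / (2 k)]. *)
Lemma gauss_integral {R : realType} (A k : R) : 0 < k ->
  lebesgue_measure.-integrable setT
    (EFin \o (fun t : R => A * expR (- (k * t ^+ 2)))) /\
  (\int[lebesgue_measure]_t (A * expR (- (k * t ^+ 2)))%:E)%E
    = (A * Num.sqrt (pi / k))%:E.
Proof.
move=> k0; pose s := Num.sqrt (2 * k)^-1.
have s0 : s != 0 by rewrite gt_eqF// sqrtr_gt0 invr_gt0 mulr_gt0.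
have s2 : s ^+ 2 = (2 * k)^-1 by rewrite sqr_sqrtr// invr_ge0 mulr_ge0 ?ltW.
have pk0 : 0 < Num.sqrt (pi / k) by rewrite sqrtr_gt0 divr_gt0 ?pi_gt0.
have pdfE t : A * expR (- (k * t ^+ 2)) =
    A * Num.sqrt (pi / k) * normal_pdf 0 s t.
  rewrite normal_pdfE// /normal_peak /normal_fun s2 subr0.
  rewrite (_ : (2 * k)^-1 * pi *+ 2 = pi / k); last first.
    by field; rewrite gt_eqF.
  rewrite (_ : - t ^+ 2 / ((2 * k)^-1 *+ 2) = - (k * t ^+ 2)); last first.
    by field; rewrite gt_eqF.
  by field; rewrite gt_eqF.
split.
  rewrite (_ : _ \o _ = (fun t => (A * Num.sqrt (pi / k))%:E
      * (normal_pdf 0 s t)%:E)%E).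
    by apply: integrableZl => //; exact: integrable_normal_pdf.
  by apply/funext => t /=; rewrite pdfE EFinM.
under eq_integral do rewrite pdfE EFinM.
rewrite integralZl//; last exact: integrable_normal_pdf.
by rewrite integral_normal_pdf mule1.
Qed.

(** * Domination and pointwise limit of the convolution terms *)

Lemma convolution_term_le {R : realType} (r1 r2 p v1 v2 b1 b2 x0 L : R)
    (alpha beta : nat -> R) :
    0 < r1 -> 0 < r2 -> 0 < p < 1 -> v1 != 0 -> v2 != 0 ->
    asymp_equiv alpha
       (fun n => v1 * (expR (r1 * (n%:R `^ p)) / (n%:R `^ b1))) ->
    asymp_equiv beta
       (fun n => v2 * (expR (r2 * (n%:R `^ p)) / (n%:R `^ b2))) ->
    0 < x0 < 1 ->
    r1 * (1 - x0) `^ (p - 1) = L -> r2 * x0 `^ (p - 1) = L ->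
  exists2 C, 0 < C & forall n k : nat, (0 < n)%N -> (k <= n)%N ->
    `|alpha (n - k)%N * beta k
      / (n%:R `^ (- b1) * n%:R `^ (- b2) * expR (n%:R `^ p * L))| <=
    C * expR (- (p * (1 - p) * (r1 + r2) / 4
                 * (n%:R `^ p * (k%:R / n%:R - x0) ^+ 2))).
Proof.
move=> r10 r20 p01 v10 v20 av bv x001 L1 L2.
have /andP[p0 p1] := p01.
(* Concavity supplies a decay [expR (- 4 e q)], with [q] the squared scaled deviation. Each of the
   two power bounds costs [expR (e q)], which leaves the [expR (- 2 e q)] of the statement. *)
pose e := p * (1 - p) * (r1 + r2) / 8.
have e0 : 0 < e by rewrite divr_gt0// mulr_gt0 ?addr_gt0// mulr_gt0 ?subr_gt0.
have x001' : 0 < 1 - x0 < 1 by lra.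
have [C1 C10 H1] := asymp_equiv_bound v10 av.
have [C2 C20 H2] := asymp_equiv_bound v20 bv.
have [D1 D10 K1] := shifted_powR_bound b1 x001' p0 e0.
have [D2 D20 K2] := shifted_powR_bound b2 x001 p0 e0.
exists (C1 * D1 * (C2 * D2)); first by rewrite !mulr_gt0.
move=> n k n0 kn.
have nR : 0 < n%:R :> R by rewrite ltr0n.
have x01 : 0 <= (k%:R / n%:R : R) <= 1.
  by rewrite divr_ge0//= ler_pdivrMr// mul1r ler_nat.
have nkE : (n - k)%:R / n%:R = 1 - k%:R / n%:R :> R.
  by rewrite natrB// mulrBl divff// gt_eqF.
have powE (j : nat) : j%:R `^ p = n%:R `^ p * (j%:R / n%:R) `^ p :> R.
  by rewrite -powRM ?divr_ge0// mulrCA divff ?mulr1// gt_eqF.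
have := phase_le p01 r10 r20 x001 L1 L2 x01.
rewrite -nkE; set q := n%:R `^ p * (k%:R / n%:R - x0) ^+ 2.
have np0 : 0 <= n%:R `^ p :> R by rewrite powR_ge0.
move=> /(ler_wpM2l np0) phase.
have {phase} : r1 * (n - k)%:R `^ p + r2 * k%:R `^ p <=
    n%:R `^ p * L - 4 * e * q.
  by rewrite (powE (n - k)%N) (powE k) /e /q; lra.
move=> phase.
have {}K1 := K1 n (n - k)%N n0 (leq_subr _ _).
have {}K2 := K2 n k n0 kn.
rewrite nkE (_ : 1 - _ - (1 - x0) = - (k%:R / n%:R - x0)) ?sqrrN in K1;
  last by ring.
have {}H1 : `|alpha (n - k)%N| <= C1 * (expR (r1 * (n - k)%:R `^ p)
    * (D1 * n%:R `^ (- b1) * expR (e * q))).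
  apply: le_trans (H1 _) _; rewrite ler_pM2l// ler_pM2l ?expR_gt0//.
have {}H2 : `|beta k| <= C2 * (expR (r2 * k%:R `^ p)
    * (D2 * n%:R `^ (- b2) * expR (e * q))).
  apply: le_trans (H2 _) _; rewrite ler_pM2l// ler_pM2l ?expR_gt0//.
have W0 : 0 < n%:R `^ (- b1) * n%:R `^ (- b2) * expR (n%:R `^ p * L).
  by rewrite !mulr_gt0 ?powR_gt0 ?expR_gt0.
rewrite normrM normfV (gtr0_norm W0) ler_pdivrMr// normrM.
apply: le_trans (ler_pM (normr_ge0 _) (normr_ge0 _) H1 H2) _.
rewrite [leLHS](_ : _ = C1 * D1 * (C2 * D2) * (n%:R `^ (- b1) * n%:R `^ (- b2))
  * expR (r1 * (n - k)%:R `^ p + r2 * k%:R `^ p + e * q + e * q)); last first.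
  by rewrite !expRD; ring.
rewrite [leRHS](_ : _ = C1 * D1 * (C2 * D2) * (n%:R `^ (- b1) * n%:R `^ (- b2))
  * expR (n%:R `^ p * L - 2 * e * q)); last first.
  rewrite (_ : - (_ * q) = - (2 * e * q)); last by rewrite /e; field.
  by rewrite expRD; ring.
rewrite ler_pM2l ?ler_expR; first by lra.
by rewrite !mulr_gt0 ?powR_gt0.
Qed.

(** The exponentials kept exact by [asymp_equiv_ratio_cvg] merge with the normalisation into the
    exponential of [n^p] times the phase minus [L], and [phase_cvg] gives the limit of this
    exponent. *)
Lemma convolution_term_cvg {R : realType} (r1 r2 p v1 v2 b1 b2 x0 L l : R)
    (alpha beta : nat -> R) (k : nat -> nat) :
    0 < p < 1 -> v1 != 0 -> v2 != 0 ->
    asymp_equiv alpha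
       (fun n => v1 * (expR (r1 * (n%:R `^ p)) / (n%:R `^ b1))) ->
    asymp_equiv beta
       (fun n => v2 * (expR (r2 * (n%:R `^ p)) / (n%:R `^ b2))) ->
    0 < x0 < 1 ->
    r1 * (1 - x0) `^ (p - 1) = L -> r2 * x0 `^ (p - 1) = L ->
    (\forall n \near \oo, (k n <= n)%N) ->
    (fun n => (k n)%:R / n%:R) @ \oo --> x0 ->
    (fun n => n%:R `^ p * ((k n)%:R / n%:R - x0) ^+ 2) @ \oo --> l ->
  (fun n => alpha (n - k n)%N * beta (k n)
      / (n%:R `^ (- b1) * n%:R `^ (- b2) * expR (n%:R `^ p * L))) @ \oo -->
    v1 * (1 - x0) `^ (- b1) * (v2 * x0 `^ (- b2))
      * expR (- (p * (1 - p) * L / (2 * x0 * (1 - x0)) * l)).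
Proof.
move=> p01 v10 v20 av bv x001 L1 L2 kn kx0 kl.
have /andP[x00 x01] := x001.
have x00' : 0 < 1 - x0 by rewrite subr_gt0.
have kx0' : (fun n => (n - k n)%:R / n%:R) @ \oo --> 1 - x0.
  apply: cvg_trans (cvgB (cvg_cst _) kx0); apply: near_eq_cvg; near=> n.
  have n0 : 0 < n%:R :> R by rewrite ltr0n; near: n; exact: nbhs_infty_gt.
  rewrite fctE/= natrB; last by near: n.
  by rewrite mulrBl divff// gt_eqF.
have H1 := asymp_equiv_ratio_cvg v10 x00' av kx0'.
have H2 := asymp_equiv_ratio_cvg v20 x00 bv kx0.
have np0 (n : nat) : 0 <= n%:R `^ p :> R by exact: powR_ge0.
have H3 := phase_cvg p01 x001 L1 L2 np0 kx0 kl.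
have H4 := cvg_comp _ expR H3 (@continuous_expR R _).
apply: cvg_trans (cvgM (cvgM H1 H2) H4); apply: near_eq_cvg; near=> n.
have n0 : 0 < n%:R :> R by rewrite ltr0n; near: n; exact: nbhs_infty_gt.
have powE (j : nat) : j%:R `^ p = n%:R `^ p * (j%:R / n%:R) `^ p :> R.
  by rewrite -powRM ?divr_ge0// mulrCA divff ?mulr1// gt_eqF.
have nkE : 1 - (k n)%:R / n%:R = (n - k n)%:R / n%:R :> R.
  by rewrite natrB; [rewrite mulrBl divff// gt_eqF|near: n].
rewrite /= !powRN nkE.
rewrite (_ : n%:R `^ p * (_ - L) = r1 * (n - k n)%:R `^ p + r2 * (k n)%:R `^ p
   - n%:R `^ p * L); last first.
  by rewrite (powE (n - k n)%N) (powE (k n)); ring.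
rewrite !expRD expRN; field.
by rewrite !gt_eqF ?powR_gt0 ?expR_gt0.
Unshelve. all: by end_near.
Qed.

(** * The window around the maximum *)

Lemma natr_half_powR {R : realType} (p : R) (n : nat) : (0 < n)%N ->
  [/\ n%:R `^ (p / 2) * (n%:R `^ (1 - p / 2) / n%:R) = 1,
      n%:R `^ (p / 2) / n%:R = n%:R `^ (- (1 - p / 2)),
      n%:R `^ (1 - p / 2) / n%:R = n%:R `^ (- (p / 2))
    & (n%:R `^ (p / 2)) ^+ 2 = n%:R `^ p].
Proof.
move=> n0; have nR : n%:R != 0 :> R by rewrite pnatr_eq0 -lt0n.
have nD x y : n%:R `^ (x + y) = n%:R `^ x * n%:R `^ y :> R.
  by rewrite powRD// nR implybT.
rewrite -(powR_inv1 (ler0n R n)) -!nD expr2 -nD; split.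
- by rewrite (_ : _ + _ = 0) ?powRr0//; lra.
- by congr (_ `^ _); lra.
- by congr (_ `^ _); lra.
- by congr (_ `^ _); lra.
Qed.

Lemma window_cvg {R : realType} (p x0 t : R) : 0 < p < 1 -> 0 < x0 < 1 ->
  let y := fun n : nat => x0 * n%:R + t * n%:R `^ (1 - p / 2) in
  let k := fun n => Num.trunc (y n) in
  [/\ \forall n \near \oo, 0 <= y n < n%:R,
      (fun n => (k n)%:R / n%:R) @ \oo --> x0
    & (fun n => n%:R `^ p * ((k n)%:R / n%:R - x0) ^+ 2) @ \oo --> t ^+ 2].
Proof.
move=> /andP[p0 p1] /andP[x00 x01] y k.
have p2 : 0 < p / 2 by lra.
have p2' : 0 < 1 - p / 2 by lra.
have near_gt0 : \forall n \near \oo, (0 < n)%N by exact: nbhs_infty_gt.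
have yE n : (0 < n)%N -> y n / n%:R = x0 + t * n%:R `^ (- (p / 2)).
  move=> n0; have [_ _ <- _] := natr_half_powR p n0.
  by rewrite /y mulrDl mulfK ?mulrA// pnatr_eq0 -lt0n.
have y_x0 : (fun n => y n / n%:R) @ \oo --> x0.
  rewrite -[X in _ --> X]addr0 -(mulr0 t).
  apply: cvg_trans (cvgD (cvg_cst _) (cvgMl_tmp (a := t) (natr_powRN_cvg0 p2))).
  apply: near_eq_cvg; near=> n; rewrite fctE/= yE//; near: n; exact: near_gt0.
have y01 : \forall n \near \oo, 0 <= y n < n%:R.
  near=> n.
  have n0 : 0 < n%:R :> R by rewrite ltr0n; near: n.
  have : 0 < y n / n%:R by near: n; exact: (cvgr_gt _ y_x0).
  have : y n / n%:R < 1 by near: n; exact: (cvgr_lt _ y_x0).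
  rewrite ltr_pdivrMr// mul1r => -> yn0.
  by rewrite andbT -[y n](divfK (lt0r_neq0 n0)) mulr_ge0// ltW.
(* [s n] recovers [t] from the truncated index. Truncation lowers [y n] by less than 1, hence [s n]
   by less than [n^(p / 2) / n], which tends to 0. *)
pose s n := n%:R `^ (p / 2) * ((k n)%:R / n%:R - x0).
have st : s @ \oo --> t.
  have lim1 : (fun n => t - n%:R `^ (- (1 - p / 2))) @ \oo --> t.
    rewrite -[X in _ --> X]subr0.
    by apply: cvgB; [exact: cvg_cst|exact: natr_powRN_cvg0].
  apply: squeeze_cvgr lim1 (cvg_cst t).
  near=> n.
  have n0 : (0 < n)%N by near: n.
  have nR : 0 < n%:R :> R by rewrite ltr0n.
  have /andP[y0 _] : 0 <= y n < n%:R by near: n.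
  have /andP[ky yk] := truncn_itv y0.
  have [E1 E2 _ _] := natr_half_powR p n0.
  have c0 : 0 < n%:R `^ (p / 2) / n%:R :> R by rewrite divr_gt0 ?powR_gt0.
  have tE : t = n%:R `^ (p / 2) / n%:R * (y n - x0 * n%:R).
    by rewrite /y addrC addKr mulrCA -mulrA (mulrC _ (_ `^ (1 - _))) E1 mulr1.
  have sE : s n = n%:R `^ (p / 2) / n%:R * ((k n)%:R - x0 * n%:R).
    by rewrite /s; field; rewrite gt_eqF.
  rewrite -E2 sE {1 2}tE -[X in _ - X]mulr1 -mulrBr !ler_pM2l//.
  by rewrite -/(k n) -natr1 in ky yk *; lra.
split => //.
- rewrite -[X in _ --> X]addr0 -(mul0r t).
  apply: cvg_trans (cvgD (cvg_cst _) (cvgM (natr_powRN_cvg0 p2) st)).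
  apply: near_eq_cvg; near=> n.
  have nR : 0 < n%:R `^ (p / 2) :> R.
    by apply: powR_gt0; rewrite ltr0n; near: n.
  by rewrite ?fctE/= /s powRN mulKf ?gt_eqF// addrC subrK.
- rewrite expr2; apply: cvg_trans (cvgM st st); apply: near_eq_cvg; near=> n.
  have n0 : (0 < n)%N by near: n.
  have [_ _ _ <-] := natr_half_powR p n0.
  by rewrite /= /s; ring.
Unshelve. all: by end_near.
Qed.

(** * Limit of the normalised convolution *)

Lemma convolution_cvg {R : realType} (r1 r2 p v1 v2 b1 b2 x0 L : R)
    (alpha beta : nat -> R) :
    0 < r1 -> 0 < r2 -> 0 < p < 1 -> v1 != 0 -> v2 != 0 ->
    asymp_equiv alpha
       (fun n => v1 * (expR (r1 * (n%:R `^ p)) / (n%:R `^ b1))) ->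
    asymp_equiv beta
       (fun n => v2 * (expR (r2 * (n%:R `^ p)) / (n%:R `^ b2))) ->
    0 < x0 < 1 ->
    r1 * (1 - x0) `^ (p - 1) = L -> r2 * x0 `^ (p - 1) = L ->
  (fun n => (\sum_(k < n.+1) alpha (n - k)%N * beta k)
      / (n%:R `^ (- b1) * n%:R `^ (- b2) * expR (n%:R `^ p * L))
      / n%:R `^ (1 - p / 2)) @ \oo -->
    v1 * (1 - x0) `^ (- b1) * (v2 * x0 `^ (- b2))
      * Num.sqrt (pi / (p * (1 - p) * L / (2 * x0 * (1 - x0)))).
Proof.
move=> r10 r20 p01 v10 v20 av bv x001 L1 L2.
have /andP[p0 p1] := p01; have /andP[x00 x01] := x001.
have x00' : 0 < 1 - x0 by rewrite subr_gt0.
have L0 : 0 < L by rewrite -L2 mulr_gt0// powR_gt0.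
set kap := p * (1 - p) * L / _.
have kap0 : 0 < kap by rewrite divr_gt0// !mulr_gt0// subr_gt0.
have [C C0 HC] := convolution_term_le r10 r20 p01 v10 v20 av bv x001 L1 L2.
set A := _ * (v2 * _).
pose d := p * (1 - p) * (r1 + r2) / 4.
have d0 : 0 < d by rewrite divr_gt0// mulr_gt0 ?addr_gt0// mulr_gt0 ?subr_gt0.
(* The dominating function. If [t] selects [k], the exact scaled position [w] of [k] satisfies
   [w <= t <= w + 1], so [t^2 / 2 <= w^2 + 1]. This turns [expR (- d w^2)] into
   [expR d * expR (- d / 2 * t^2)]. *)
have [intD _] := gauss_integral (C * expR d) (divr_gt0 d0 (ltr0Sn R 1)).
have [_ intG] := gauss_integral A kap0.
pose W n := n%:R `^ (- b1) * n%:R `^ (- b2) * expR (n%:R `^ p * L) : R.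
pose c n k := alpha (n.+1 - k)%N * beta k / W n.+1.
(* Shifting the index avoids [n = 0], where the window width [n^(1 - p / 2)] is 0. *)
rewrite -cvg_shiftS.
have h0 (n : nat) : 0 < n.+1%:R `^ (1 - p / 2) :> R by rewrite powR_gt0.
suff : (fun n => ((\sum_(k < n.+2) c n k) / n.+1%:R `^ (1 - p / 2))%:E) @ \oo
    --> (A * Num.sqrt (pi / kap))%:E.
  move=> /fine_cvg; apply: cvg_trans; apply: near_eq_cvg; apply: nearW => n.
  by rewrite /= /c -mulr_suml.
rewrite -intG.
apply: (riemann_sum_dominated_cvg (N := fun n => n.+2)
  (m := fun n => x0 * n.+1%:R) h0 intD) => [t|n k t kn ty|t|t].
- by rewrite mulr_ge0 ?expR_ge0// mulr_ge0 ?expR_ge0// ltW.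
- apply: le_trans (HC n.+1 k isT kn) _.
  rewrite -/d -[leRHS]mulrA ler_pM2l// -expRD ler_expR.
  have [_ _ _ <-] := natr_half_powR p (ltn0Sn n).
  have [E1 _ _ _] := natr_half_powR p (ltn0Sn n).
  set u := n.+1%:R `^ (p / 2) in E1 *; set h := n.+1%:R `^ (1 - p / 2) in E1 ty.
  have nR : 0 < n.+1%:R :> R by [].
  have h1 : 1 <= h by rewrite -[leLHS](powRr0 n.+1%:R) ler_powR ?ler1n//; lra.
  have hh : 0 < h by exact: h0.
  have uE : u * (k%:R / n.+1%:R - x0) = (k%:R - x0 * n.+1%:R) / h.
    apply: (@mulIf _ h); first by rewrite gt_eqF.
    rewrite /= divfK ?gt_eqF//.
    transitivity (u * (h / n.+1%:R) * (k%:R - x0 * n.+1%:R)).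
      by field; rewrite gt_eqF.
    by rewrite E1 mul1r.
  rewrite -exprMn uE; set w := _ / h.
  have /andP[w1 w2] : w <= t <= w + 1.
    rewrite /w ler_pdivrMr// -lerBlDr ler_pdivlMr//.
    by rewrite -natr1 in ty; nra.
  have : t ^+ 2 / 2 <= w ^+ 2 + 1.
    have tw : (t - w) ^+ 2 <= 1 by rewrite expr_le1 //; lra.
    by have := sqr_ge0 (w - (t - w)); lra.
  move=> /(ler_wpM2l (ltW d0)); lra.
- have [[M _ HM] _ _] := window_cvg t p01 x001.
  exists M => // n /= Mn; have /andP[-> yn] := HM n.+1 (leqW Mn).
  by rewrite (lt_trans yn)// ltr_nat.
- have [yn kx kt] := window_cvg t p01 x001.
  have kn : \forall n \near \oo,
     (Num.trunc (x0 * n%:R + t * n%:R `^ (1 - p / 2)) <= n)%N.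
    move: yn; apply: filterS => n /andP[y0 yn].
    have /andP[ky _] := truncn_itv y0.
    by rewrite -(ler_nat R) (le_trans ky)// ltW.
  have := convolution_term_cvg p01 v10 v20 av bv x001 L1 L2 kn kx kt.
  by rewrite -cvg_shiftS.
Qed.

(** * Closed form of the constant and conclusion *)

(** After taking logarithms, both sides are the same linear combination of [ln s1], [ln s2] and
    [ln S]. *)
Lemma saddle_point_powR {R : realType} (p b1 b2 s1 s2 : R) :
    0 < s1 -> 0 < s2 -> let S := s1 + s2 in
  S `^ (b1 + b2 - 1 / 2 * (3 - p)) / (s1 `^ (b1 - 1 / 2) * s2 `^ (b2 - 1 / 2))
  = (s1 / S) `^ (- b1) * (s2 / S) `^ (- b2)
    * (s1 `^ 2^-1 * s2 `^ 2^-1 * S `^ ((p - 3) * 2^-1)).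
Proof.
move=> s10 s20 S; have S0 : 0 < S by exact: addr_gt0.
have powE x y : 0 < x -> x `^ y = expR (y * ln x) :> R.
  by move=> x0; rewrite /powR gt_eqF.
rewrite !powE ?divr_gt0// !ln_div ?posrE// -!expRD -expRN -expRD.
by congr expR; lra.
Qed.

Lemma saddle_point_const {R : realType} (p b1 b2 s1 s2 : R) :
    0 < s1 -> 0 < s2 -> 0 < p < 1 -> let S := s1 + s2 in
  (s1 / S) `^ (- b1) * (s2 / S) `^ (- b2)
    * Num.sqrt (pi / (p * (1 - p) * S `^ (1 - p) / (2 * (s2 / S) * (s1 / S))))
  = Num.sqrt (2 * pi) * S `^ (b1 + b2 - 1 / 2 * (3 - p))
    / (Num.sqrt ((1 - p) * p) * s1 `^ (b1 - 1 / 2) * s2 `^ (b2 - 1 / 2)).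
Proof.
move=> s10 s20 /andP[p0 p1] S; have S0 : 0 < S by exact: addr_gt0.
have p1' : 0 < 1 - p by rewrite subr_gt0.
have sqrtE : Num.sqrt (pi / (p * (1 - p) * S `^ (1 - p)
                            / (2 * (s2 / S) * (s1 / S))))
  = Num.sqrt (2 * pi) / Num.sqrt ((1 - p) * p)
    * (s1 `^ 2^-1 * s2 `^ 2^-1 * S `^ ((p - 3) * 2^-1)).
  have pi0 := @pi_gt0 R.
  rewrite powRrM !powR12_sqrt ?powR_ge0 ?ltW// -sqrtrV; last first.
    by rewrite mulr_ge0 ?ltW.
  rewrite -!sqrtrM ?mulr_ge0 ?invr_ge0 ?powR_ge0 ?mulr_ge0 ?ltW//.
  (* The [S^2] split off here cancels against the denominators of [s1 / S] and [s2 / S]. *)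
  have -> : S `^ (1 - p) = (S `^ (p - 3))^-1 / S ^+ 2.
    rewrite -powRN -(powR_mulrn 2 (ltW S0)) -powRB ?(gt_eqF S0) ?implybT//.
    by congr (_ `^ _); lra.
  congr Num.sqrt; field.
  by rewrite !gt_eqF// powR_gt0.
rewrite sqrtE; transitivity (Num.sqrt (2 * pi) / Num.sqrt ((1 - p) * p)
  * (S `^ (b1 + b2 - 1 / 2 * (3 - p))
     / (s1 `^ (b1 - 1 / 2) * s2 `^ (b2 - 1 / 2)))).
  by rewrite saddle_point_powR//; ring.
field; rewrite !gt_eqF ?powR_gt0// sqrtr_gt0; exact: mulr_gt0.
Qed.

Theorem theorem1 (R : realType) (r1 r2 p v1 v2 b1 b2 : R)
    (alpha beta a : nat -> R)
    (r1_gt0 : 0 < r1) (r2_gt0 : 0 < r2) (p_gt0 : 0 < p) (p_lt1 : p < 1)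
    (v1_neq0 : v1 != 0) (v2_neq0 : v2 != 0)
    (alpha_equiv : asymp_equiv alpha
       (fun n => v1 * (expR (r1 * (n%:R `^ p)) / (n%:R `^ b1))))
    (beta_equiv : asymp_equiv beta
       (fun n => v2 * (expR (r2 * (n%:R `^ p)) / (n%:R `^ b2))))
    (a_def : forall n : nat,
       a n = \sum_(k < n.+1) alpha (n - k)%N * beta k) :
  let S := (r1 `^ (1 / (1 - p))) + (r2 `^ (1 / (1 - p))) in
  asymp_equiv a
    (fun n =>
       (Num.sqrt (2 * pi) * v1 * v2
          * (S `^ (b1 + b2 - 1 / 2 * (3 - p)))
          * expR ((n%:R `^ p) * (S `^ (1 - p))))
       / (Num.sqrt ((1 - p) * p)
          * (r1 `^ ((b1 - 1 / 2) / (1 - p)))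
          * (r2 `^ ((b2 - 1 / 2) / (1 - p)))
          * (n%:R `^ (b1 + b2 + p / 2 - 1)))).
Proof.
set s1 := r1 `^ (1 / (1 - p)); set s2 := r2 `^ (1 / (1 - p)) => S.
have p01 : 0 < p < 1 by rewrite p_gt0.
have p1 : 0 < 1 - p by rewrite subr_gt0.
have s10 : 0 < s1 by exact: powR_gt0.
have s20 : 0 < s2 by exact: powR_gt0.
have S0 : 0 < S by exact: addr_gt0.
have rE r b : r `^ (b / (1 - p)) = (r `^ (1 / (1 - p))) `^ b.
  by rewrite -powRrM mulrC mul1r mulrC.
(* Applied to both pairs, this shows that [x0 = s2 / S] balances the two derivatives, with common
   value [L = S^(1 - p)]. *)
have critical s r : 0 < s -> r = s `^ (1 - p) ->
    r * (s / S) `^ (p - 1) = S `^ (1 - p).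
  move=> s0 ->; rewrite powRM ?invr_ge0 ?ltW// mulrA -powRD; last first.
    by rewrite (gt_eqF s0) implybT.
  rewrite (_ : 1 - p + (p - 1) = 0) ?powRr0 ?mul1r; last by lra.
  by rewrite -(powR_inv1 (ltW S0)) -powRrM; congr (_ `^ _); lra.
have rs r : 0 < r -> r = (r `^ (1 / (1 - p))) `^ (1 - p).
  by move=> r0; rewrite -powRrM divfK ?gt_eqF// powRr1// ltW.
have x0E : 1 - s2 / S = s1 / S by rewrite /S; field; rewrite gt_eqF.
have x001 : 0 < s2 / S < 1.
  by rewrite divr_gt0//= ltr_pdivrMr// mul1r /S ltrDr.
have := convolution_cvg r1_gt0 r2_gt0 p01 v1_neq0 v2_neq0 alpha_equiv
  beta_equiv x001 _ (critical _ _ s20 (rs _ r2_gt0)).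
rewrite x0E => /(_ (critical _ _ s10 (rs _ r1_gt0))).
set Lim := _ * Num.sqrt _ => limP.
(* A nonzero limit can be divided out, which turns the convergence of the normalised sum into an
   equivalence. *)
have Lim0 : Lim != 0.
  rewrite !mulf_neq0 ?(gt_eqF (powR_gt0 _ (divr_gt0 _ S0)))//.
  by rewrite gt_eqF// sqrtr_gt0 !divr_gt0 ?mulr_gt0 ?invr_gt0 ?powR_gt0 ?pi_gt0.
rewrite /asymp_equiv -[X in _ --> X](divff Lim0).
apply: cvg_trans (cvgMr_tmp (b := Lim^-1) limP); apply: near_eq_cvg; near=> n.
have nR : 0 < n%:R :> R by rewrite ltr0n; near: n; exact: nbhs_infty_gt.
rewrite /= -a_def.
have LimE : Lim = v1 * v2 * ((s1 / S) `^ (- b1) * (s2 / S) `^ (- b2)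
    * Num.sqrt (pi / (p * (1 - p) * S `^ (1 - p) / (2 * (s2 / S) * (s1 / S))))).
  by rewrite /Lim; ring.
rewrite LimE saddle_point_const// -/S.
rewrite (rE r1 (b1 - 1 / 2)) (rE r2 (b2 - 1 / 2)) -/s1 -/s2.
(* The power of [n] in the result combines the two coefficient powers with the window width
   [n^(1 - p / 2)]. *)
have -> : n%:R `^ (b1 + b2 + p / 2 - 1)
    = n%:R `^ b1 * n%:R `^ b2 / n%:R `^ (1 - p / 2) :> R.
  rewrite -powRN -!powRD ?(gt_eqF nR) ?implybT//.
  by congr (_ `^ _); lra.
rewrite !powRN; field.
have q0 : 0 < (1 - p) * p by exact: mulr_gt0.
have pi2 : 0 < 2 * pi :> R by rewrite mulr_gt0 ?pi_gt0.
by rewrite v1_neq0 v2_neq0 !gt_eqF ?powR_gt0 ?expR_gt0 ?sqrtr_gt0.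
Unshelve. all: by end_near.
Qed.
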